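(* Assume $0<\Delta_1<U$, $\Delta_2-\Delta_1>2U$ and $\Delta_1+\Delta_2<4U$. Then the set of stable configurations $\mathcal X_{\mathrm{stab}}=\{\eta\in\mathcal X: H(\eta)=\min_{\xi\in\mathcal X}H(\xi)\}$ satisfies $\mathcal X_{\mathrm{stab}}=\boxplus$.
   Context: Coordinates. A site $i\in\mathbb Z^2$ with standard coordinates $(x_1,x_2)$ has dual coordinates $u_1=(x_1-x_2)/2$, $u_2=(x_1+x_2)/2$. Two sites are adjacent ($i\sim j$) if they are at Euclidean distance 1 in standard coordinates; equivalently both their dual coordinates differ by exactly $1/2$ in absolute value. Box. Let $\varepsilon=4U-\Delta_1-\Delta_2>0$, $\ell^\star=\lceil\Delta_1/\varepsilon\rceil$, and fix $L\in\mathbb N$ with $L>2\ell^\star$. $\Lambda\subset\mathbb Z^2$ is an $(L+\frac32)\times(L+\frac32)$ dual square, i.e. $\Lambda=\{i: a_k\le u_k(i)\le a_k+L+\frac32,\ k=1,2\}$ for some fixed $a_1,a_2\in\frac12\mathbb Z$ (centred as nearly as possible at the origin). $\partial^-\Lambda$ is the set of sites of $\Lambda$ adjacent to a site outside $\Lambda$, and $\Lambda^-=\Lambda\setminus\partial^-\Lambda$ (an $(L+\frac12)\times(L+\frac12)$ dual square). Energy. Configurations are $\eta\in\mathcal X=\{0,1,2\}^\Lambda$ (0 = empty, 1 or 2 = particle of that type), with energy $$H(\eta)=-U\,\#\{\text{unordered adjacent pairs }\{x,y\}\subset\Lambda^-:\eta(x)\eta(y)=2\}+\Delta_1\#\{x\in\Lambda:\eta(x)=1\}+\Delta_2\#\{x\in\Lambda:\eta(x)=2\}.$$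 The set $\boxplus$. A 2-tile is a site occupied by a particle of type 2 together with its four adjacent sites, all occupied by particles of type 1. $\boxplus$ is the set consisting of the two configurations in which $\Lambda$ is filled with the largest possible checkerboard droplet such that all particles of type 2 are surrounded by particles of type 1. Explicitly: the type-2 particles occupy an $L\times L$ array of sites inside $\Lambda^-$ with consecutive sites at dual distance 1 along the $u_1$- and $u_2$-axes, every site adjacent to one of them lies in $\Lambda^-$ and is occupied by a particle of type 1, and all other sites of $\Lambda$ are empty. There are two such configurations: one in which the type-2 particles sit on sites with $x_1+x_2$ even, and one in which they sit on sites with $x_1+x_2$ odd. *)

(* Defs.v *)
From HB Require Import structures.
From mathcomp Require Import all_boot all_order all_algebra finmap.
From mathcomp Require Import boolp classical_sets cardinality reals.
From mathcomp Require Import zify ring lra.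

Set Implicit Arguments.
Unset Strict Implicit.
Unset Printing Implicit Defensive.

Import Order.TTheory GRing.Theory Num.Theory.
Local Open Scope ring_scope.

Definition site : Type := (int * int)%type.

(* Dual coordinates; they take values in (1/2)Z, hence the type rat. *)
Definition u1 (i : site) : rat := (i.1 - i.2)%:~R / 2.
Definition u2 (i : site) : rat := (i.1 + i.2)%:~R / 2.

(* Euclidean distance 1, written with the squared distance. *)
Definition adj (i j : site) : bool := (i.1 - j.1) ^+ 2 + (i.2 - j.2) ^+ 2 == 1.

Definition half_integer (a : rat) : Prop := 2 * a \is a Num.int.

Definition side (L : nat) : rat := L%:R + 3 / 2.

(* Each centre coordinate a_k + side / 2 of the box is as close to 0 as a
   half-integer lower corner allows; this leaves two choices of a_k. *)
Definition centred (L : nat) (a : rat) : Prop :=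
  forall b : rat, half_integer b -> `|a + side L / 2| <= `|b + side L / 2|.

(* [fset_set] sends an infinite set to the empty one; this box is finite, and
   [in_Lambda] below gives its elements. *)
Definition Lambda (L : nat) (a1 a2 : rat) : {fset site} :=
  fset_set [set i : site | (a1 <= u1 i <= a1 + side L) &&
                           (a2 <= u2 i <= a2 + side L)]%classic.

Lemma in_Lambda (L : nat) (a1 a2 : rat) (i : site) :
  (i \in Lambda L a1 a2) =
  (a1 <= u1 i <= a1 + side L) && (a2 <= u2 i <= a2 + side L).
Proof.
rewrite in_fset_set; last first.
  pose N := (Num.bound `|a1 + a2|%R + Num.bound `|a2 - a1|%R + (2 * L).+4)%N.
  pose g (p : 'I_(N + N) * 'I_(N + N)) : site :=
    ((p.1 : nat)%:Z - N%:Z, (p.2 : nat)%:Z - N%:Z).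
  apply: (@sub_finite_set _ _ (g @` setT)%classic); last first.
    by apply: finite_image; exact: finite_finset.
  have bnd (z : int) : `|z%:~R : rat| < N%:R ->
      exists k : 'I_(N + N), (k : nat)%:Z - N%:Z = z.
    rewrite -intr_norm -[N%:R]/(N%:Z%:~R) ltr_int => zN.
    have kN : (absz (z + N%:Z)%R < N + N)%N by lia.
    by exists (Ordinal kN) => /=; lia.
  have NE : (N%:R : rat) =
      (Num.bound `|a1 + a2|%R)%:R + (Num.bound `|a2 - a1|%R)%:R +
      (2 * L%:R + 4).
    by rewrite !natrD -addn4 natrD natrM.
  have b1' : `|a1 + a2| < (Num.bound `|a1 + a2|%R)%:R by exact: archi_boundP.
  have b2' : `|a2 - a1| < (Num.bound `|a2 - a1|%R)%:R by exact: archi_boundP.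
  move=> j /=; rewrite /u1 /u2 /side => /andP[/andP[h1 h2] /andP[h3 h4]].
  have L0 : 0 <= L%:R :> rat by [].
  have [k1 e1] : exists k : 'I_(N + N), (k : nat)%:Z - N%:Z = j.1.
    apply: bnd; rewrite NE.
    move: h1 h2 h3 h4; rewrite rmorphB rmorphD /=.
    move: b1' b2'; rewrite !ltr_norml => /andP[? ?] /andP[? ?] *.
    by apply/andP; split; lra.
  have [k2 e2] : exists k : 'I_(N + N), (k : nat)%:Z - N%:Z = j.2.
    apply: bnd; rewrite NE.
    move: h1 h2 h3 h4; rewrite rmorphB rmorphD /=.
    move: b1' b2'; rewrite !ltr_norml => /andP[? ?] /andP[? ?] *.
    by apply/andP; split; lra.
  by exists (k1, k2) => //=; rewrite /g /= e1 e2; case: j {h1 h2 h3 h4 e1 e2}.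
by apply/idP/idP; rewrite inE.
Qed.

Definition boundary (L : nat) (a1 a2 : rat) : {fset site} :=
  [fset i in Lambda L a1 a2 |
     `[< exists j : site, j \notin Lambda L a1 a2 /\ adj i j >]]%fset.

Definition Lambda_minus (L : nat) (a1 a2 : rat) : {fset site} :=
  (Lambda L a1 a2 `\` boundary L a1 a2)%fset.

Definition config (L : nat) (a1 a2 : rat) : finType :=
  {ffun Lambda L a1 a2 -> 'I_3}.

(* The set of unordered pairs {x, y}, each pair being a two-element set. *)
Definition bonds (L : nat) (a1 a2 : rat) (eta : config L a1 a2) :
    {set {set Lambda L a1 a2}} :=
  [set e | [exists x : Lambda L a1 a2, exists y : Lambda L a1 a2,
     [&& e == [set x; y],
         val x \in Lambda_minus L a1 a2, val y \in Lambda_minus L a1 a2,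
         adj (val x) (val y) & (eta x * eta y)%N == 2%N]]].

Definition energy (R : realType) (U Delta1 Delta2 : R) (L : nat) (a1 a2 : rat)
    (eta : config L a1 a2) : R :=
  - U * #|bonds eta|%:R
  + Delta1 * #|[set x : Lambda L a1 a2 | eta x == 1%N :> nat]|%:R
  + Delta2 * #|[set x : Lambda L a1 a2 | eta x == 2%N :> nat]|%:R.

Definition empty_config (L : nat) (a1 a2 : rat) : config L a1 a2 :=
  [ffun=> ord0].

(* The energy of the empty configuration is only the seed of the iterated
   minimum; it is itself one of the values over which the minimum runs. *)
Definition min_energy (R : realType) (U Delta1 Delta2 : R) (L : nat)
    (a1 a2 : rat) : R :=
  \big[Num.min/energy U Delta1 Delta2 (empty_config L a1 a2)]_
    (xi : config L a1 a2) energy U Delta1 Delta2 xi.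

Definition stable (R : realType) (U Delta1 Delta2 : R) (L : nat)
    (a1 a2 : rat) : {set config L a1 a2} :=
  [set eta | energy U Delta1 Delta2 eta == min_energy U Delta1 Delta2 L a1 a2].

Definition epsilon (R : realType) (U Delta1 Delta2 : R) : R :=
  4 * U - Delta1 - Delta2.

Definition lstar (R : realType) (U Delta1 Delta2 : R) : int :=
  Num.ceil (Delta1 / epsilon U Delta1 Delta2).

(* The L x L array of sites with lower corner c and unit dual spacing. *)
Definition in_array (L : nat) (c i : site) : bool :=
  [exists m : 'I_L, exists n : 'I_L,
     (u1 i == u1 c + m%:R) && (u2 i == u2 c + n%:R)].

Definition checkerboard (L : nat) (a1 a2 : rat) (eta : config L a1 a2) : Prop :=
  exists c : site,
    [/\ forall i, in_array L c i -> i \in Lambda_minus L a1 a2,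
        forall i j, in_array L c i -> adj i j -> j \in Lambda_minus L a1 a2,
        forall x : Lambda L a1 a2, in_array L c (val x) -> eta x = 2%N :> nat,
        forall x y : Lambda L a1 a2, in_array L c (val x) ->
          adj (val x) (val y) -> eta y = 1%N :> nat
      & forall y : Lambda L a1 a2, ~~ in_array L c (val y) ->
          (forall x : Lambda L a1 a2,
             in_array L c (val x) -> ~~ adj (val x) (val y)) ->
          eta y = 0%N :> nat].

(* Exactly two configurations: [Lambda_minus] leaves room for one choice of the
   corner c on each of the two sublattices x1 + x2 even and x1 + x2 odd. *)
Definition boxplus (L : nat) (a1 a2 : rat) : {set config L a1 a2} :=
  [set eta | `[< checkerboard eta >]].

(* Main.v *)
Require Import Defs.
From HB Require Import structures.
From mathcomp Require Import all_boot all_order all_algebra reals.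
From mathcomp Require Import finmap boolp zify ring lra.
Import Order.TTheory GRing.Theory Num.Theory.
Local Open Scope fset_scope.
Local Open Scope ring_scope.

Set Implicit Arguments.
Unset Strict Implicit.
Unset Printing Implicit Defensive.


(** Write e for 4 U - Delta1 - Delta2. A droplet whose particles of type 2 form
    an L x L array has L^2 of them, each with four bonds, and (L+1)^2 particles
    of type 1, hence energy

      E0 = Delta1 (L+1)^2 + (Delta2 - 4 U) L^2 = Delta1 (2 L + 1) - e L^2.

    The theorem says that every energy is at least E0, with equality only for
    these droplets, and the proof is a direct chain of inequalities.

    Charging ([charge_ge], [droplet_bound]). Each particle of type 2 receives
    the energy Delta2 - U b, where b is its number of bonds. With b <= 2 this
    is positive since Delta2 > 2 U, so such particles only cost energy. The
    others, with b = 3 or b = 4, have at most one neighbouring site that is not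
    occupied by type 1. If two of them are adjacent, each is the missing
    neighbour of the other, and one of the two is dropped. This leaves an
    independent set T of t sites. The missing neighbours of T that would have
    to be filled with type 1 cost Delta1 < U each, less than the bonds they
    would bring. A dropped particle costs Delta2 - 3 U, which may be negative,
    but its partner has a surplus U - Delta1, and the sum Delta2 - Delta1 - 2 U
    is positive. So the energy is at least
    Delta1 |N(T)| - (4 U - Delta2) t = Delta1 (|N(T)| - t) - e t, with N(T) the
    set of neighbours of T. For empty T this is 0 > E0.

    Isoperimetry ([card_neighbourhood]). If T is nonempty and occupies r lines
    u1 = const and c lines u2 = const, then |N(T)| >= t + r + c + 1.

    Packing ([card_independent_le], [card_le_shadows]). A particle with at
    least three neighbours of type 1 in the inner box lies off the border of
    the inner box, in a square that a perfect matching splits into L^2 adjacent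
    pairs; so t <= L^2. Trivially t <= r c.

    Optimization ([droplet_arith]). If r + c >= 2 L, then t <= L^2 already gives
    the bound. If r + c = 2 L - k with k > 0, then L^2 - r c >= k L / 2, and
    e L > 2 Delta1, which is what L > 2 l* provides, makes the lost volume
    energy e (L^2 - t) exceed the saved perimeter energy Delta1 k. Equality
    forces t = L^2 and r = c = L, so T is a product of two sets of L lines
    ([grid_of_full]); parity leaves two possible positions in each direction. *)

(** * Isoperimetry in dual coordinates *)

Lemma fset_argmin (K : choiceType) (g : K -> int) (S : {fset K}) (x : K) :
  x \in S -> exists2 y, y \in S & forall z, z \in S -> g y <= g z.
Proof.
move=> xS.
have [y _ ymin] := @arg_minP _ _ S (FSetSub xS) xpredT (fun z => g (val z)) isT.
exists (val y) => [|z zS]; first exact: valP.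
exact: (ymin (FSetSub zS)).
Qed.

(** The fibres of [f] are invariant under the shift [tau], which increases [g];
    in each nonempty fibre of [S] the [g]-minimal element is not the shift of an
    element of [S]. Thus [S] has one element outside [tau @` S] for each value
    of [f] on [S]. *)
Lemma card_fsetU_shift (K K' : choiceType) (tau : K -> K) (f : K -> K')
    (g : K -> int) (S : {fset K}) :
  injective tau -> (forall x, f (tau x) = f x) ->
  (forall x, g x < g (tau x)) ->
  (#|` S| + #|` f @` S| <= #|` S `|` tau @` S|)%N.
Proof.
move=> tau_inj f_inv g_lt.
have -> : S `|` tau @` S = tau @` S `|` (S `\` tau @` S).
  by rewrite fsetUDl fsetDv fsetD0 fsetUC.
rewrite cardfsU fsetIDA [_ `&` S]fsetIC -fsetIDA fsetDv fsetI0 cardfs0 subn0.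
rewrite (card_imfset _ _ tau_inj) leq_add2l.
apply: (@leq_trans #|` f @` (S `\` tau @` S)|); last exact: leq_imfset_card.
apply: fsubset_leq_card.
apply/fsubsetP => _ /imfsetP[x /= xS ->].
have xF : x \in [fset y in S | f y == f x] by rewrite !inE xS /=.
have [y] := fset_argmin g xF.
rewrite !inE /= => /andP[yS /eqP fy] ymin.
apply/imfsetP; exists y => //=; rewrite !inE yS andbT.
apply/imfsetP => -[z /= zS yE].
have := ymin z; rewrite !inE /= zS -fy yE f_inv eqxx => /(_ isT).
by rewrite leNgt g_lt.
Qed.

(** Twice the dual coordinates, so that they are integers; they always have the
    same parity, and adjacency means that both change by exactly 1. *)
Definition pcoord (i : site) : int := i.1 - i.2.
Definition qcoord (i : site) : int := i.1 + i.2.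

Lemma site_eqP (i j : site) :
  (i == j) = (pcoord i == pcoord j) && (qcoord i == qcoord j).
Proof.
case: i j => [x y] [x' y']; rewrite /pcoord /qcoord xpair_eqE /=.
by apply/andP/andP => -[]; lia.
Qed.

Definition neighbours (i : site) : seq site :=
  [:: (i.1 + 1, i.2); (i.1 - 1, i.2); (i.1, i.2 + 1); (i.1, i.2 - 1)].

Lemma adjE (i j : site) : adj i j = (j \in neighbours i).
Proof.
case: i j => [x y] [x' y']; rewrite /adj /neighbours !inE !xpair_eqE /=.
apply/eqP/idP; last first.
  by case/or4P => /andP[/eqP-> /eqP->]; ring.
move=> h.
have hx : (x - x') ^+ 2 <= 1 by rewrite -h lerDl sqr_ge0.
have hy : (y - y') ^+ 2 <= 1 by rewrite -h lerDr sqr_ge0.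
have : -1 <= x - x' <= 1 by apply/andP; split; nia.
have : -1 <= y - y' <= 1 by apply/andP; split; nia.
move=> /andP[? ?] /andP[? ?].
have [E|[E|E]] : x - x' = -1 \/ x - x' = 0 \/ x - x' = 1 by lia.
all: have [F|[F|F]] : y - y' = -1 \/ y - y' = 0 \/ y - y' = 1 by lia.
all: by move: h; rewrite E F // => _; lia.
Qed.

Lemma adjC (i j : site) : adj i j = adj j i.
Proof. by rewrite /adj -sqrrN opprB -[X in _ + X]sqrrN opprB. Qed.

Lemma adj_coord (i j : site) :
  adj i j = (`|pcoord i - pcoord j| == 1) && (`|qcoord i - qcoord j| == 1).
Proof.
rewrite adjE; case: i j => [x y] [x' y'].
rewrite /pcoord /qcoord /neighbours !inE !xpair_eqE /=.
by apply/idP/idP; lia.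
Qed.

Definition neighbourhood (T : {fset site}) : {fset site} :=
  [fset j | i in T, j in neighbours i].

Lemma neighbourhoodP (T : {fset site}) (j : site) :
  reflect (exists2 i, i \in T & adj i j) (j \in neighbourhood T).
Proof.
apply: (iffP idP) => [/imfset2P[i /= iT [k kn ->]]|[i iT]].
  by exists i; rewrite ?adjE.
by rewrite adjE => jn; apply/imfset2P; exists i => //; exists j.
Qed.

(** The unit dual steps, which change one of the two doubled dual coordinates by
    2 and keep the other. *)
Definition step_q (i : site) : site := (i.1 + 1, i.2 + 1).
Definition step_p (i : site) : site := (i.1 + 1, i.2 - 1).

Lemma step_q_inj : injective step_q.
Proof. by move=> [a b] [c d] [/addIr -> /addIr ->]. Qed.

Lemma step_p_inj : injective step_p.
Proof. by move=> [a b] [c d] [/addIr -> /addIr ->]. Qed.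

(** Up to the translation by (1, 0), the neighbourhood of [T] is obtained by
    uniting [T] with its shift along one dual axis and then the result with its
    shift along the other axis. The first union adds one site for each line met
    in the first direction, the second one for each line met in the other; the
    final 1 appears because the first union also enlarges the second shadow. *)
Lemma card_neighbourhood (T : {fset site}) : T != fset0 ->
  (#|` T| + #|` pcoord @` T| + #|` qcoord @` T| + 1 <=
     #|` neighbourhood T|)%N.
Proof.
case/fset0Pn => i0 i0T.
pose T1 := T `|` step_q @` T; pose T2 := T1 `|` step_p @` T1.
have h1 : (#|` T| + #|` pcoord @` T| <= #|` T1|)%N.
  apply: (@card_fsetU_shift _ _ step_q pcoord qcoord) => [|x|x].
  - exact: step_q_inj.
  - by rewrite /pcoord /=; ring.
  - by rewrite /qcoord /=; lia.
have h2 : (#|` T1| + #|` qcoord @` T1| <= #|` T2|)%N.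
  apply: (@card_fsetU_shift _ _ step_p qcoord pcoord) => [|x|x].
  - exact: step_p_inj.
  - by rewrite /qcoord /=; ring.
  - by rewrite /pcoord /=; lia.
(* The shift lemma on the integers, with a single fibre. *)
have h3 : (#|` qcoord @` T| + 1 <= #|` qcoord @` T1|)%N.
  have -> : qcoord @` T1 = qcoord @` T `|` (fun z => z + 2) @` (qcoord @` T).
    rewrite imfsetU -!imfset_comp; congr (_ `|` _); apply: eq_imfset => // x /=.
    by rewrite /qcoord /=; ring.
  apply: leq_trans (@card_fsetU_shift _ _ (fun z => z + 2) (fun=> tt) id _ _ _ _).
  - rewrite leq_add2l cardfs_gt0; apply/fset0Pn; exists tt.
    by apply/imfsetP; exists (qcoord i0) => //=; exact: in_imfset.
  - exact: addIr.
  - by [].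
  - by move=> x /=; lia.
have shiftE : (fun i : site => (i.1 + 1, i.2)) @` neighbourhood T = T2.
  apply/fsetP => j; apply/imfsetP/idP => /=.
    move=> [k /neighbourhoodP[i iT]]; rewrite adjE !inE => kn ->.
    have s1 : step_q i \in step_q @` T by exact: in_imfset.
    have s2 : i \in T1 by rewrite inE iT.
    have s3 : step_q i \in T1 by rewrite inE s1 orbT.
    case/or4P: kn => /eqP -> /=.
    + have -> : (i.1 + 1 + 1, i.2) = step_p (step_q i).
        by rewrite /step_p /=; congr pair; ring.
      by rewrite [_ \in step_p @` _]in_imfset ?orbT.
    + have -> : (i.1 - 1 + 1, i.2) = i.
        by case: (i) => ? ? /=; congr pair; ring.
      by rewrite iT.
    + by rewrite -/(step_q i) s1 orbT.
    + by rewrite -/(step_p i) [_ \in step_p @` _]in_imfset ?orbT.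
  rewrite /T2 /T1 !inE => /orP[/orP[jT|/imfsetP[i /= iT ->]]|/imfsetP[k /= ]].
  - exists (j.1 - 1, j.2) => /=; last by case: (j) => ? ? /=; congr pair; ring.
    by apply/neighbourhoodP; exists j => //; rewrite adjE !inE eqxx orbT.
  - exists (i.1, i.2 + 1) => //; apply/neighbourhoodP; exists i => //.
    by rewrite adjE !inE eqxx !orbT.
  - rewrite !inE => /orP[kT|/imfsetP[i /= iT ->]] ->.
      exists (k.1, k.2 - 1) => //; apply/neighbourhoodP; exists k => //.
      by rewrite adjE !inE eqxx !orbT.
    exists (i.1 + 1, i.2); last by rewrite /step_p /=; congr pair; ring.
    by apply/neighbourhoodP; exists i => //; rewrite adjE !inE eqxx.
have <- : #|` T2| = #|` neighbourhood T|.
  by rewrite -shiftE card_imfset // => -[a b] [c d] [/addIr -> ->].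
lia.
Qed.

(** * Packing *)
Lemma card_fsetM (K K' : choiceType) (A : {fset K}) (B : {fset K'}) :
  #|` A `*` B| = (#|` A| * #|` B|)%N.
Proof.
have -> : A `*` B = [fset x in [seq (x, y) | x <- A, y <- B]].
  apply/fsetP => -[x y]; rewrite in_fsetM !inE /=.
  by apply/andP/allpairsP => [[xA yB]|[[x' y'] [? ? [-> ->]]]];
    first exists (x, y).
rewrite card_fseq undup_id ?size_allpairs //.
by apply: allpairs_uniq; rewrite ?fset_uniq // => -[? ?] [? ?] _ _ [-> ->].
Qed.

Definition dual_pair (i : site) : int * int := (pcoord i, qcoord i).

Lemma dual_pair_inj : injective dual_pair.
Proof. by move=> i j [pE qE]; apply/eqP; rewrite site_eqP pE qE !eqxx. Qed.

Lemma dual_pair_subset (T : {fset site}) :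
  dual_pair @` T `<=` (pcoord @` T) `*` (qcoord @` T).
Proof.
by apply/fsubsetP => _ /imfsetP[i /= iT ->]; rewrite in_fsetM /= !in_imfset.
Qed.

Lemma card_le_shadows (T : {fset site}) :
  (#|` T| <= #|` pcoord @` T| * #|` qcoord @` T|)%N.
Proof.
rewrite -card_fsetM.
by have := fsubset_leq_card (dual_pair_subset T); rewrite card_imfset //;
  exact: dual_pair_inj.
Qed.

(** A set with as many sites as the product of its shadows is that product. *)
Lemma shadows_full (T : {fset site}) :
  #|` T| = (#|` pcoord @` T| * #|` qcoord @` T|)%N ->
  forall i j, i \in T -> j \in T ->
  exists2 k, k \in T & pcoord k = pcoord i /\ qcoord k = qcoord j.
Proof.
move=> cardT i j iT jT.
have /eqP fullT : dual_pair @` T == (pcoord @` T) `*` (qcoord @` T).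
  rewrite eqEfcard dual_pair_subset card_fsetM -cardT.
  by rewrite (card_imfset _ _ dual_pair_inj) leqnn.
have : (pcoord i, qcoord j) \in dual_pair @` T.
  by rewrite fullT in_fsetM /= !in_imfset.
by case/imfsetP => k /= kT [-> ->]; exists k.
Qed.

Definition window (a b : int) (n : nat) (i : site) : bool :=
  (a <= pcoord i < a + n%:Z) && (b <= qcoord i < b + n%:Z).

Definition square (n : nat) : {fset nat * nat} :=
  [fset k in iota 0 n] `*` [fset k in iota 0 n].

Lemma in_square (n : nat) (m : nat * nat) :
  (m \in square n) = (m.1 < n)%N && (m.2 < n)%N.
Proof. by rewrite in_fsetM !inE !mem_iota. Qed.

Lemma card_square (n : nat) : #|` square n| = (n * n)%N.
Proof. by rewrite card_fsetM !card_fseq !undup_id ?iota_uniq // size_iota. Qed.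

(** The window splits into n x n cells of 2 x 2 values of the doubled dual
    coordinates. By parity a cell contains exactly two sites, and these are
    adjacent, so an independent set has at most one site in each cell. *)
Lemma card_independent_le (a b : int) (n : nat) (T : {fset site}) :
  {in T, forall i, window a b (2 * n) i} ->
  {in T &, forall i j, ~~ adj i j} -> (#|` T| <= n * n)%N.
Proof.
move=> Tin Tind.
pose cell (i : site) :=
  (absz ((pcoord i - a) %/ 2)%Z, absz ((qcoord i - b) %/ 2)%Z).
have cell_inj : {in T &, injective cell}.
  move=> i j iT jT [cellp cellq].
  have := Tind i j iT jT; have := Tin i iT; have := Tin j jT.
  rewrite adj_coord /window => winj wini nadj.
  apply/eqP; rewrite site_eqP.
  by move: cellp cellq nadj winj wini; rewrite /pcoord /qcoord; lia.
have <- : #|` cell @` T| = #|` T| by exact: card_in_imfset.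
rewrite -card_square; apply/fsubset_leq_card/fsubsetP => _ /imfsetP[i /= iT ->].
by rewrite in_square /=; have := Tin i iT; rewrite /window; lia.
Qed.

Definition grid_site (c : site) (m : nat * nat) : site :=
  (c.1 + m.1%:Z + m.2%:Z, c.2 - m.1%:Z + m.2%:Z).

Definition grid (n : nat) (c : site) : {fset site} :=
  grid_site c @` square n.

Lemma grid_site_inj (c : site) : injective (grid_site c).
Proof.
by case: c => x y [m n] [m' n'] [] /= e e'; congr pair; lia.
Qed.

Lemma card_grid (n : nat) (c : site) : #|` grid n c| = (n * n)%N.
Proof. by rewrite card_imfset ?card_square //; exact: grid_site_inj. Qed.

Lemma gridP (n : nat) (c i : site) :
  reflect (exists m : nat * nat, [/\ (m.1 < n)%N, (m.2 < n)%N,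
             pcoord i = pcoord c + 2 * m.1%:Z &
             qcoord i = qcoord c + 2 * m.2%:Z])
          (i \in grid n c).
Proof.
apply: (iffP idP) => [/imfsetP[m /=]|[m [m1 m2 pE qE]]].
  rewrite in_square => /andP[? ?] ->; exists m; split=> //.
    by rewrite /pcoord /=; ring.
  by rewrite /qcoord /=; ring.
apply/imfsetP; exists m => /=; first by rewrite in_square m1.
by apply/eqP; rewrite site_eqP pE qE /pcoord /qcoord /=; lia.
Qed.

(** All sites of a full product have the same parities: any two of them are
    linked by a third one that shares one coordinate with each, and the two
    coordinates of a site have equal parities. A window of width 2n has n values
    of each parity, so the product is a grid; the remainder modulo 2 of a site
    relative to the corner of the window gives the corner of the grid. *)
Lemma grid_of_full (a b : int) (n : nat) (T : {fset site}) :
  {in T, forall i, window a b (2 * n) i} -> #|` T| = (n * n)%N -> (0 < n)%N ->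
  #|` pcoord @` T| = n -> #|` qcoord @` T| = n ->
  exists2 c, window a b 2 c & T = grid n c.
Proof.
move=> Tin cardT n_gt0 cardp cardq.
have /fset0Pn[i0 i0T] : T != fset0.
  by rewrite -cardfs_gt0 cardT muln_gt0 n_gt0.
have full := @shadows_full T; rewrite cardT cardp cardq in full.
have same_parity i : i \in T ->
    exists k l : int, pcoord i = pcoord i0 + 2 * k /\
                      qcoord i = qcoord i0 + 2 * l.
  move=> iT.
  have [k kT] := full erefl i i0 iT i0T.
  have parity j : exists z : int, pcoord j = qcoord j + 2 * z.
    by exists (- j.2); rewrite /pcoord /qcoord; ring.
  have [z1 e1] := parity i; have [z2 e2] := parity i0; have [z3 e3] := parity k.
  by move=> [ek1 ek2]; exists (z3 - z2), (z3 - z1); lia.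
pose s := ((pcoord i0 - a) %/ 2)%Z; pose t := ((qcoord i0 - b) %/ 2)%Z.
pose c : site := (i0.1 - s - t, i0.2 + s - t).
have cp : pcoord c = pcoord i0 - 2 * s by rewrite /pcoord /=; ring.
have cq : qcoord c = qcoord i0 - 2 * t by rewrite /qcoord /=; ring.
have cwin : window a b 2 c.
  by have := Tin _ i0T; rewrite /window cp cq /s /t; lia.
exists c => //; apply/eqP; rewrite eqEfcard cardT card_grid leqnn andbT.
apply/fsubsetP => i iT; apply/gridP.
have [k [l [pE qE]]] := same_parity i iT.
exists (absz (s + k), absz (t + l)) => /=.
by have := Tin i iT; move: cwin; rewrite /window; split; lia.
Qed.

(** * Charging the energy to independent particles of type 2 *)

(** Here [A1] and [A2] stand for the sets of particles of type 1 and 2 in the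
    inner box. *)
Definition ones_around (A1 : {fset site}) (i : site) : nat :=
  count (fun j => j \in A1) (neighbours i).

(** The default value [i] is attained when all neighbours lie in [A1]. *)
Definition missing (A1 : {fset site}) (i : site) : site :=
  nth i (neighbours i) (find (fun j => j \notin A1) (neighbours i)).

Lemma missingE (A1 : {fset site}) (i j : site) :
  (2 < ones_around A1 i)%N -> adj i j -> j \notin A1 -> missing A1 i = j.
Proof.
rewrite adjE /ones_around /missing /neighbours !inE /= => ones.
move=> jn jA1; move: ones; have jF := negPf jA1.
by case/or4P: jn jF => /eqP <- ->; do 3 case: (_ \in A1).
Qed.

Lemma ones_around_lt4 (A1 : {fset site}) (i j : site) :
  adj i j -> j \notin A1 -> (ones_around A1 i <= 3)%N.
Proof.
rewrite adjE /ones_around -ltnS => jn jA1.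
rewrite -[4%N]/(size (neighbours i)) ltn_neqAle count_size andbT -all_count.
by apply/allPn; exists j.
Qed.

(** A site outside the smaller window has at least two neighbours outside the
    larger one. *)
Lemma ones_around_interior (a b : int) (n : nat) (A1 : {fset site}) (i : site) :
  {in A1, forall j, window (a - 1) (b - 1) (2 * n).+2 j} ->
  (2 < ones_around A1 i)%N -> window a b (2 * n) i.
Proof.
move=> A1in ones; apply/negPn/negP => iout; move: ones; apply/negP.
rewrite -leqNgt.
have two_out j k : j \in neighbours i -> k \in neighbours i -> j != k ->
    ~~ window (a - 1) (b - 1) (2 * n).+2 j ->
    ~~ window (a - 1) (b - 1) (2 * n).+2 k -> (ones_around A1 i <= 2)%N.
  have out l : ~~ window (a - 1) (b - 1) (2 * n).+2 l -> (l \in A1) = false.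
    by move=> lout; apply/negbTE; apply: contra lout; exact: A1in.
  rewrite !inE => jn kn jk /out + /out; move: jk; rewrite /ones_around /=.
  by case/or4P: jn => /eqP ->; case/or4P: kn => /eqP ->;
     rewrite ?eqxx // => _ -> ->; do 2 case: (_ \in A1).
have [lt|le] := ltP (pcoord i) a.
  apply: (two_out (i.1 - 1, i.2) (i.1, i.2 + 1)); rewrite ?inE ?eqxx ?orbT //;
    by move: lt; rewrite ?xpair_eqE /window /pcoord /qcoord /=; lia.
have [lt'|le'] := ltP (qcoord i) b.
  apply: (two_out (i.1 - 1, i.2) (i.1, i.2 - 1)); rewrite ?inE ?eqxx ?orbT //;
    by move: lt'; rewrite ?xpair_eqE /window /pcoord /qcoord /=; lia.
have [lt2|le2] := leP (a + (2 * n)%:Z) (pcoord i).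
  apply: (two_out (i.1 + 1, i.2) (i.1, i.2 - 1)); rewrite ?inE ?eqxx ?orbT //;
    by move: lt2; rewrite ?xpair_eqE /window /pcoord /qcoord /=; lia.
have lt2' : b + (2 * n)%:Z <= qcoord i.
  by move: iout le le' le2; rewrite /window; lia.
apply: (two_out (i.1 + 1, i.2) (i.1, i.2 + 1)); rewrite ?inE ?eqxx ?orbT //;
  by move: lt2'; rewrite ?xpair_eqE /window /pcoord /qcoord /=; lia.
Qed.

(** With at most two bonds a particle of type 2 costs energy by itself; the
    heavy ones are those that can lower the energy. *)
Definition heavy (A1 A2 : {fset site}) : {fset site} :=
  [fset i in A2 | (2 < ones_around A1 i)%N].

(** Adjacent sites have different parities of [pcoord], so this removes exactly
    one site of each adjacent pair of heavy particles. *)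
Definition dropped (A1 A2 : {fset site}) : {fset site} :=
  [fset i in heavy A1 A2 | (2 %| pcoord i)%Z &&
     has (fun j => j \in heavy A1 A2) (neighbours i)].

Definition kept (A1 A2 : {fset site}) : {fset site} :=
  heavy A1 A2 `\` dropped A1 A2.

Definition deficient (A1 A2 : {fset site}) : {fset site} :=
  [fset i in kept A1 A2 | ones_around A1 i == 3%N].

Lemma adj_parity (i j : site) :
  adj i j -> (2 %| pcoord i)%Z = ~~ (2 %| pcoord j)%Z.
Proof. by rewrite adj_coord => /andP[]; lia. Qed.

Lemma heavyP (A1 A2 : {fset site}) (i : site) :
  reflect (i \in A2 /\ (2 < ones_around A1 i)%N) (i \in heavy A1 A2).
Proof. by rewrite !inE; exact: andP. Qed.

Lemma droppedP (A1 A2 : {fset site}) (i : site) :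
  reflect [/\ i \in heavy A1 A2, (2 %| pcoord i)%Z &
             exists2 j, j \in heavy A1 A2 & adj i j]
          (i \in dropped A1 A2).
Proof.
apply: (iffP idP) => [|[iH pi [j jH ij]]].
  rewrite inE => /andP[iH /andP[pi /hasP[j jn jH]]]; split=> //.
  by exists j; rewrite ?adjE.
rewrite inE; apply/andP; split=> //; apply/andP; split=> //.
apply/hasP; exists j => //.
by rewrite -adjE.
Qed.

Lemma keptP (A1 A2 : {fset site}) (i : site) :
  reflect (i \in heavy A1 A2 /\ i \notin dropped A1 A2) (i \in kept A1 A2).
Proof. by rewrite in_fsetD andbC; exact: andP. Qed.

Lemma kept_independent (A1 A2 : {fset site}) :
  {in kept A1 A2 &, forall i j, ~~ adj i j}.
Proof.
move=> i j /keptP[iH iD] /keptP[jH jD]; apply/negP => ij.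
have [pi|pi] := boolP (2 %| pcoord i)%Z.
  by case/negP: iD; apply/droppedP; split=> //; exists j.
case/negP: jD; apply/droppedP; split=> //; last by exists i => //; rewrite adjC.
by rewrite (adj_parity (i := j) (j := i)) // adjC.
Qed.

(** A neighbour of a kept particle that is not in [A1] is the only missing
    neighbour of that particle, which is then deficient. *)
Lemma card_neighbourhood_kept (A1 A2 : {fset site}) :
  (#|` neighbourhood (kept A1 A2)| <= #|` A1| + #|` deficient A1 A2|)%N.
Proof.
set N := neighbourhood _.
have sub : N `\` A1 `<=` missing A1 @` deficient A1 A2.
  apply/fsubsetP => j; rewrite inE => /andP[jA1 /neighbourhoodP[i iK ij]].
  have /keptP[/heavyP[iA2 ones] _] := iK.
  apply/imfsetP; exists i; last by rewrite (missingE ones ij jA1).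
  rewrite /= inE; apply/andP; split=> //.
  by rewrite eqn_leq (ones_around_lt4 ij jA1).
have mK : (#|` missing A1 @` deficient A1 A2| <= #|` deficient A1 A2|)%N.
  exact: leq_imfset_card.
have := fsubset_leq_card sub.
have := fsubset_leq_card (fsubsetIr N A1); have := cardfsID A1 N; lia.
Qed.

(** A dropped particle and its heavy neighbour are the missing neighbours of
    each other, so [missing] is injective on the dropped particles, and the partner
    is kept and deficient. *)
Lemma card_dropped (A1 A2 : {fset site}) : [disjoint A1 & A2] ->
  (#|` dropped A1 A2| <= #|` deficient A1 A2|)%N.
Proof.
move=> /fdisjointP A12.
have A2N i : i \in A2 -> i \notin A1 by apply: contraL => /A12.
have partner i : i \in dropped A1 A2 -> missing A1 i \in deficient A1 A2 /\
    missing A1 (missing A1 i) = i.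
  case/droppedP => /heavyP[iA2 ones] pi [j jH ij].
  have /heavyP[jA2 onesj] := jH.
  have ji : adj j i by rewrite adjC.
  rewrite (missingE ones ij (A2N j jA2)) (missingE onesj ji (A2N i iA2)).
  split=> //; rewrite inE; apply/andP; split=> /=.
    apply/keptP; split=> //; apply/droppedP => -[_ pj _].
    by move: pi; rewrite (adj_parity ij) pj.
  by rewrite eqn_leq (ones_around_lt4 ji (A2N i iA2)).
have inj : {in dropped A1 A2 &, injective (missing A1)}.
  by move=> i j /partner[_ {2}<-] /partner[_ {2}<-] ->.
have <- : #|` missing A1 @` dropped A1 A2| = #|` dropped A1 A2|.
  exact: card_in_imfset.
by apply/fsubset_leq_card/fsubsetP => _ /imfsetP[i /= /partner[iK _] ->].
Qed.

Lemma sum_indicator (R : pzSemiRingType) (A B : {fset site}) : B `<=` A ->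
  \sum_(i <- A) (i \in B)%:R = #|` B|%:R :> R.
Proof.
move=> BA; rewrite card_fset_sum1 natr_sum -(big_fset_incl _ BA) /=.
  by rewrite big_seq [RHS]big_seq; apply: eq_bigr => i ->.
by move=> i _ /negbTE ->.
Qed.

Lemma charge_ge (R : realType) (U Delta2 : R) (A1 A2 : {fset site}) :
  0 < U -> [disjoint A1 & A2] ->
  (Delta2 - 4 * U) * #|` kept A1 A2|%:R + U * #|` deficient A1 A2|%:R
  + (Delta2 - 3 * U) * #|` dropped A1 A2|%:R
  + (Delta2 - 2 * U) * #|` A2 `\` heavy A1 A2|%:R
  <= \sum_(i <- A2) (Delta2 - U * (ones_around A1 i)%:R).
Proof.
move=> U_gt0 A12.
have A2N i : i \in A2 -> i \notin A1.
  by apply: contraL => iA1; move/fdisjointP: A12; exact.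
have HA2 : heavy A1 A2 `<=` A2 by apply/fsubsetP => i /heavyP[].
have KH : kept A1 A2 `<=` heavy A1 A2 by exact: fsubsetDl.
have DH : dropped A1 A2 `<=` heavy A1 A2 by apply/fsubsetP => i /droppedP[].
have SK : deficient A1 A2 `<=` kept A1 A2.
  by apply/fsubsetP => i; rewrite inE => /andP[].
rewrite -(sum_indicator R (fsubset_trans KH HA2)).
rewrite -(sum_indicator R (fsubset_trans (fsubset_trans SK KH) HA2)).
rewrite -(sum_indicator R (fsubset_trans DH HA2)).
rewrite -(sum_indicator R (fsubsetDl A2 (heavy A1 A2))).
(* All terms become sums over A2, so that the comparison is pointwise. *)
rewrite !mulr_sumr -!big_split /= big_seq [leRHS]big_seq.
apply: ler_sum => i iA2.
have ones4 : (ones_around A1 i <= 4)%N by exact: count_size.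
have -> : (i \in deficient A1 A2) =
    (i \in kept A1 A2) && (ones_around A1 i == 3%N).
  by rewrite inE.
rewrite !in_fsetD iA2 andbT.
have -> : (i \in heavy A1 A2) = (2 < ones_around A1 i)%N.
  by apply/heavyP/idP => [[]|].
have [/droppedP[/heavyP[_ ones2] _ [j /heavyP[jA2 _] ij]]|_] :=
  boolP (i \in dropped A1 A2).
  have ones3 := ones_around_lt4 ij (A2N j jA2).
  have -> : ones_around A1 i = 3%N by apply/eqP; rewrite eqn_leq ones3.
  by rewrite /=; lra.
move: ones4; rewrite leq_eqVlt => /orP[/eqP->|]; first by rewrite /=; lra.
rewrite leq_eqVlt => /orP[/eqP[->]|]; first by rewrite /=; lra.
rewrite !ltnS => ones2; rewrite ltnNge ones2 /=.
have : U * (ones_around A1 i)%:R <= U * 2 by rewrite ler_pM2l // ler_nat.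
lra.
Qed.

(** * Optimization *)
Lemma droplet_arith (R : realType) (D1 e : R) (n N t p q : nat) :
  0 < D1 -> 0 < e -> 2 * D1 + e <= e * n%:R ->
  t = 0%N \/ (t + p + q + 1 <= N)%N -> (t <= n * n)%N -> (t <= p * q)%N ->
  D1 * (n.+1 * n.+1)%:R - (e + D1) * (n * n)%:R <= D1 * N%:R - (e + D1) * t%:R
    ?= iff [&& N == (n.+1 * n.+1)%N, t == (n * n)%N, p == n & q == n].
Proof.
move=> D1_gt0 e_gt0 en tN tn tpq.
suff [lt|[tE NE pE qE]] :
    D1 * (n.+1 * n.+1)%:R - (e + D1) * (n * n)%:R < D1 * N%:R - (e + D1) * t%:R
    \/ [/\ t = (n * n)%N, N = (n.+1 * n.+1)%N, p = n & q = n].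
- split; first exact: ltW.
  rewrite lt_eqF //; apply/esym/negP => /and4P[/eqP NE /eqP tE _ _].
  by move: lt; rewrite NE tE ltxx.
- by rewrite tE NE pE qE !eqxx; split; rewrite ?lexx ?eqxx.
have n0 : 0 <= n%:R :> R by [].
have t0 : 0 <= t%:R :> R by [].
rewrite !natrM -natr1.
case: tN => [->|tN].
  left; have N0 : 0 <= D1 * N%:R by rewrite mulr_ge0 // ltW.
  have : (2 * D1 + e) * n%:R <= e * n%:R * n%:R by rewrite ler_wpM2r.
  lra.
have tNR : D1 * (t%:R + p%:R + q%:R + 1) <= D1 * N%:R.
  by rewrite ler_pM2l // -!natrD -[1]/(1%:R) -natrD ler_nat.
have [lt_pq|le_pq] := ltnP (p + q) (2 * n).
  left.
  have [k kE] : exists k, (2 * n = p + q + k.+1)%N.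
    by exists (2 * n - (p + q)).-1; lia.
  (* From 4 p q <= (p + q)^2 and (2 n)^2 - (p + q)^2 = k' (2 n + p + q),
     where k' = k.+1. *)
  have gap : (4 * t + 2 * n * k.+1 <= 4 * (n * n))%N.
    have [agm _] := nat_AGM2 p q; rewrite -mulnn in agm.
    have sq : (2 * n * (2 * n) = (p + q) * (p + q) + (p + q + 2 * n) * k.+1)%N.
      by rewrite kE; ring.
    have : (2 * n * k.+1 <= (p + q + 2 * n) * k.+1)%N.
      by rewrite leq_mul2r leq_addl orbT.
    lia.
  have kR : 2 * n%:R = p%:R + q%:R + k.+1%:R :> R by rewrite -natrM kE !natrD.
  have gapR : 4 * t%:R + 2 * n%:R * k.+1%:R <= 4 * (n%:R * n%:R) :> R.
    by rewrite -!natrM -natrD ler_nat.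
  have egap := ler_wpM2l (ltW e_gt0) gapR.
  have k0 : 0 < k.+1%:R :> R by rewrite ltr0n.
  have ek := ler_wpM2r (ltW k0) en.
  have : 0 < e * k.+1%:R by rewrite mulr_gt0.
  have : D1 * (2 * n%:R) = D1 * (p%:R + q%:R + k.+1%:R) by rewrite kR.
  lra.
have le_pqR : D1 * (2 * n%:R) <= D1 * (p%:R + q%:R).
  by rewrite ler_pM2l // -natrM -natrD ler_nat.
move: tn; rewrite leq_eqVlt => /orP[/eqP tE|lt_t].
  have tER : t%:R = n%:R * n%:R :> R by rewrite tE natrM.
  move: le_pq; rewrite leq_eqVlt => /orP[/eqP pqE|lt_pq].
    have pE : p = n by nia.
    have qE : q = n by lia.
    move: tN; rewrite leq_eqVlt => /orP[/eqP NE|lt_N].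
      by right; split=> //; lia.
    left.
    have : D1 * (t%:R + p%:R + q%:R + 1) < D1 * N%:R.
      by rewrite ltr_pM2l // -!natrD -[1]/(1%:R) -natrD ltr_nat.
    rewrite pE qE tER; lra.
  left; have : D1 * (2 * n%:R) < D1 * (p%:R + q%:R).
    by rewrite ltr_pM2l // -natrM -natrD ltr_nat.
  rewrite tER in tNR *; lra.
left; have : e * t%:R < e * (n%:R * n%:R) by rewrite ltr_pM2l // -natrM ltr_nat.
lra.
Qed.

(** The charging inequality gives [E] at least
    [D1 * #|N| + (D2 - 4 * U) * #|T|] plus four nonnegative terms. If [E] is
    minimal, these vanish: no particle is dropped, deficient or light, so
    [A2 = T] and [A1] is exactly the neighbourhood of [T]. *)
Lemma droplet_bound (R : realType) (U D1 D2 : R) (a b : int) (n : nat)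
    (A1 A2 : {fset site}) :
  0 < D1 -> D1 < U -> 2 * U < D2 - D1 -> D1 + D2 < 4 * U -> (0 < n)%N ->
  2 * D1 + (4 * U - D1 - D2) <= (4 * U - D1 - D2) * n%:R ->
  [disjoint A1 & A2] ->
  {in A1, forall j, window (a - 1) (b - 1) (2 * n).+2 j} ->
  let E0 := D1 * (n.+1 * n.+1)%:R + (D2 - 4 * U) * (n * n)%:R in
  let E := D1 * #|` A1|%:R + \sum_(i <- A2) (D2 - U * (ones_around A1 i)%:R) in
  E0 <= E /\ (E <= E0 -> exists2 c, window a b 2 c &
                  A2 = grid n c /\ A1 = neighbourhood (grid n c)).
Proof.
move=> D1_gt0 D1U D21 D12 n_gt0 en A12 A1in E0 E.
have U_gt0 : 0 < U by lra.
set T := kept A1 A2; set K := deficient A1 A2.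
set D := dropped A1 A2; set S := A2 `\` heavy A1 A2; set N := neighbourhood T.
have Tin : {in T, forall i, window a b (2 * n) i}.
  by move=> i /keptP[/heavyP[_ ones] _]; exact: ones_around_interior A1in ones.
have Tn := card_independent_le Tin (@kept_independent A1 A2).
have ar := @droplet_arith R D1 (4 * U - D1 - D2) n #|` N| #|` T| _ _ D1_gt0.
have {ar} := ar _ _ _ en _ Tn (card_le_shadows T).
have -> : 4 * U - D1 - D2 + D1 = - (D2 - 4 * U) by ring.
rewrite !mulNr !opprK -/E0 => ar.
have [||le_bound eq_bound] := ar; first by lra.
  have [->|/card_neighbourhood] := eqVneq T fset0; last by right.
  by left; rewrite cardfs0.
have charge := charge_ge D2 U_gt0 A12; rewrite -/T -/K -/D -/S in charge.
have NK : #|` N|%:R <= #|` A1|%:R + #|` K|%:R :> R.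
  by rewrite -natrD ler_nat; exact: card_neighbourhood_kept.
have DK : #|` D|%:R <= #|` K|%:R :> R by rewrite ler_nat; exact: card_dropped.
have S0 : 0 <= #|` S|%:R :> R by [].
have D0 : 0 <= #|` D|%:R :> R by [].
have slack : D1 * #|` N|%:R + (D2 - 4 * U) * #|` T|%:R
    + D1 * (#|` A1|%:R + #|` K|%:R - #|` N|%:R)
    + (U - D1) * (#|` K|%:R - #|` D|%:R) + (D2 - D1 - 2 * U) * #|` D|%:R
    + (D2 - 2 * U) * #|` S|%:R <= E.
  by rewrite /E; lra.
have p1 : 0 <= D1 * (#|` A1|%:R + #|` K|%:R - #|` N|%:R).
  by rewrite mulr_ge0 ?subr_ge0 // ltW.
have p2 : 0 <= (U - D1) * (#|` K|%:R - #|` D|%:R).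
  by rewrite mulr_ge0 ?subr_ge0 // ltW.
have p3 : 0 <= (D2 - D1 - 2 * U) * #|` D|%:R.
  by rewrite mulr_ge0 // subr_ge0 ltW.
have p4 : 0 <= (D2 - 2 * U) * #|` S|%:R.
  by rewrite mulr_ge0 // subr_ge0 ltW //; lra.
split; first by lra.
move=> EE0.
have z1 : D1 * (#|` A1|%:R + #|` K|%:R - #|` N|%:R) = 0 by lra.
have z2 : (U - D1) * (#|` K|%:R - #|` D|%:R) = 0 by lra.
have z3 : (D2 - D1 - 2 * U) * #|` D|%:R = 0 by lra.
have z4 : (D2 - 2 * U) * #|` S|%:R = 0 by lra.
have : E0 == D1 * #|` N|%:R + (D2 - 4 * U) * #|` T|%:R by apply/eqP; lra.
rewrite eq_bound => /and4P[_ /eqP cardT /eqP cardp /eqP cardq].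
have Dnil : D = fset0.
  by apply/cardfs0_eq/eqP; rewrite -(pnatr_eq0 R); apply/eqP; nra.
have Snil : S = fset0.
  by apply/cardfs0_eq/eqP; rewrite -(pnatr_eq0 R); apply/eqP; nra.
have Knil : K = fset0.
  apply/cardfs0_eq/eqP; rewrite -(pnatr_eq0 R); apply/eqP.
  by move: z2; rewrite Dnil cardfs0; nra.
have [c cwin TE] := grid_of_full Tin cardT n_gt0 cardp cardq.
exists c => //.
have A2E : A2 = T.
  apply/eqP; rewrite eqEfsubset -fsetD_eq0 /T /kept -/D Dnil fsetD0 -/S Snil.
  by rewrite eqxx; apply/fsubsetP => i /heavyP[].
split; first by rewrite A2E.
rewrite -TE -/N; apply/esym/eqP; rewrite eqEfcard.
have cardNA : #|` A1| = #|` N|.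
  apply/eqP; rewrite -(eqr_nat R); apply/eqP.
  by move: z1; rewrite Knil cardfs0; nra.
rewrite cardNA leqnn andbT; apply/fsubsetP => j /neighbourhoodP[i iT ij].
apply/negPn/negP => jA1.
have /keptP[/heavyP[_ ones] _] := iT.
have : i \in K.
  rewrite inE; apply/andP; split=> //=.
  by rewrite eqn_leq (ones_around_lt4 ij jA1).
by rewrite Knil inE.
Qed.

(** * The box and the energy of a configuration *)
Lemma in_Lambda_window (L : nat) (a1 a2 : rat) (A B : int) (i : site) :
  2 * a1 = A%:~R -> 2 * a2 = B%:~R ->
  (i \in Lambda L a1 a2) = window A B (2 * L).+4 i.
Proof.
have corner (a : rat) (C z : int) : 2 * a = C%:~R ->
    (a <= z%:~R / 2 <= a + side L) = (C <= z < C + (2 * L).+4%:Z).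
  move=> aC; have -> : a = C%:~R / 2 by lra.
  have -> : C%:~R / 2 + side L = (C + (2 * L + 3)%:Z)%:~R / 2.
    rewrite intrD /side -[((2 * L + 3)%:Z)%:~R]/((2 * L + 3)%:R).
    by rewrite natrD natrM; lra.
  by rewrite !ler_pM2r // !ler_int; lia.
by move=> aA bB; rewrite in_Lambda /u1 /u2 (corner _ A) // (corner _ B).
Qed.

Lemma in_Lambda_minus_window (L : nat) (a1 a2 : rat) (A B : int) (i : site) :
  2 * a1 = A%:~R -> 2 * a2 = B%:~R ->
  (i \in Lambda_minus L a1 a2) = window (A + 1) (B + 1) (2 * L).+2 i.
Proof.
move=> aA bB; have inL j := in_Lambda_window L j aA bB.
have inB : (i \in boundary L a1 a2) =
    (i \in Lambda L a1 a2) &&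
    has (fun j => j \notin Lambda L a1 a2) (neighbours i).
  rewrite inE; congr (_ && _); apply/asboolP/hasP => -[j].
    by rewrite adjE => -[jL jn]; exists j.
  by rewrite -adjE => ij jL; exists j.
rewrite in_fsetD inB; case: (boolP (i \in _)) => [|]; rewrite inL /=.
  move=> iL; rewrite andbT !inL /window /pcoord /qcoord /=.
  by move: iL; rewrite /window /pcoord /qcoord; lia.
by rewrite /window; lia.
Qed.

Lemma ones_aroundE (A1 : {fset site}) (i : site) :
  ones_around A1 i = #|` [fset j in A1 | adj i j]|.
Proof.
rewrite /ones_around -size_filter.
have -> : [fset j in A1 | adj i j] =
    [fset j in [seq j <- neighbours i | j \in A1]].
  by apply/fsetP => j; rewrite !inE mem_filter adjE.
rewrite card_fseq undup_id // filter_uniq //.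
by case: i => x y; rewrite /= !inE !xpair_eqE; lia.
Qed.

Definition inner (L : nat) (a1 a2 : rat) (eta : config L a1 a2) (k : nat) :
    {set Lambda L a1 a2} :=
  [set x | (val x \in Lambda_minus L a1 a2) && (eta x == k :> nat)].

Lemma in_inner (L : nat) (a1 a2 : rat) (eta : config L a1 a2) k x :
  (x \in inner eta k) = (val x \in Lambda_minus L a1 a2) && (eta x == k :> nat).
Proof. by rewrite inE. Qed.

Definition particles (L : nat) (a1 a2 : rat) (eta : config L a1 a2) (k : nat) :
    {fset site} :=
  val @` inner eta k.

Lemma card_val_image (A : {fset site}) (S : {set A}) : #|` val @` S| = #|S|.
Proof. by rewrite card_imfset /=; [rewrite -cardE | exact: val_inj]. Qed.

(** A bond has exactly one end of type 2, so bonds correspond to ordered pairs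
    of a particle of type 2 and one of type 1. *)
Lemma card_bonds (L : nat) (a1 a2 : rat) (eta : config L a1 a2) :
  #|bonds eta| =
  (\sum_(i <- particles eta 2) ones_around (particles eta 1) i)%N.
Proof.
pose P := [set xy : Lambda L a1 a2 * Lambda L a1 a2 |
  [&& xy.1 \in inner eta 2, xy.2 \in inner eta 1 & adj (val xy.1) (val xy.2)]].
have -> : bonds eta = [set [set xy.1; xy.2] | xy in P].
  apply/setP => e; rewrite inE; apply/existsP/imsetP => [[x /existsP[y]]|].
    case/and5P => /eqP -> xM yM xy.
    have [vx vy] := (ltn_ord (eta x), ltn_ord (eta y)).
    move=> prod; have /orP[/andP[x2 y1]|/andP[x1 y2]] :
      ((eta x == 2 :> nat) && (eta y == 1 :> nat)) ||
      ((eta x == 1 :> nat) && (eta y == 2 :> nat)).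
    + move: prod vx vy; case: (nat_of_ord (eta x)) => [|[|[|]]] //;
        by case: (nat_of_ord (eta y)) => [|[|[|]]].
    + by exists (x, y) => //; rewrite inE /= !in_inner xM yM x2 y1.
    + by exists (y, x); rewrite 1?setUC // inE /= !in_inner xM yM x1 y2 adjC.
  move=> [[x y]]; rewrite inE /= !in_inner.
  move=> /and3P[/andP[xM /eqP x2] /andP[yM /eqP y1] xy] ->.
  exists x; apply/existsP; exists y; rewrite eqxx xM yM xy /=.
  by rewrite x2 y1.
rewrite card_in_imset; last first.
  move=> [x y] [x' y']; rewrite ![_ \in P]inE /= !in_inner.
  move=> /and3P[/andP[_ /eqP x2] /andP[_ /eqP y1] _].
  move=> /and3P[/andP[_ /eqP x2'] /andP[_ /eqP y1'] _] /setP ee.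
  have := ee x; rewrite !inE eqxx /= => /esym/orP[/eqP xx|/eqP xy]; last first.
    by move: x2; rewrite xy y1'.
  have := ee y; rewrite !inE eqxx orbT /= => /esym/orP[/eqP yx|/eqP yy].
    by move: y1; rewrite yx x2'.
  by rewrite xx yy.
rewrite /particles big_imfset /=; last by move=> x y _ _; exact: val_inj.
rewrite big_enum /= -sum1_card.
rewrite (eq_bigl (fun xy => (xy.1 \in inner eta 2) &&
   ((xy.2 \in inner eta 1) && adj (val xy.1) (val xy.2)))); last first.
  by move=> xy; rewrite inE.
rewrite -(pair_big_dep (mem (inner eta 2))
  (fun x y => (y \in inner eta 1) && adj (val x) (val y)) (fun _ _ => 1%N)) /=.
apply: eq_bigr => x _.
rewrite ones_aroundE sum1_card.
have -> : [fset j in val @` inner eta 1 | adj (val x) j] =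
    val @` [set y | (y \in inner eta 1) && adj (val x) (val y)].
  apply/fsetP => j; rewrite in_fset !inE.
  apply/andP/imfsetP => [[/imfsetP[y /= yI ->] xy]|[y /=]].
    by exists y => //=; rewrite inE yI.
  by rewrite inE => /andP[yI xy] ->; split=> //; exact: in_imfset.
by rewrite card_val_image cardsE.
Qed.

(** Particles of the boundary layer have no bonds, so they enter only through
    the last two terms. *)
Lemma energyE (R : realType) (U D1 D2 : R) (L : nat) (a1 a2 : rat)
    (eta : config L a1 a2) :
  energy U D1 D2 eta =
  D1 * #|` particles eta 1|%:R
  + \sum_(i <- particles eta 2) (D2 - U * (ones_around (particles eta 1) i)%:R)
  + D1 * #|[set x | eta x == 1 :> nat] :\: inner eta 1|%:R
  + D2 * #|[set x | eta x == 2 :> nat] :\: inner eta 2|%:R.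
Proof.
have split_card k : #|[set x | eta x == k :> nat]| =
    (#|` particles eta k| + #|[set x | eta x == k :> nat] :\: inner eta k|)%N.
  rewrite card_val_image -[LHS](cardsID (inner eta k)) (setIidPr _) //.
  by apply/subsetP => x; rewrite in_inner => /andP[_ xk]; rewrite inE.
rewrite /energy card_bonds !split_card !natrD natr_sum sumrB -mulr_sumr.
rewrite big_const_seq count_predT iter_addr addr0 -mulr_natr.
ring.
Qed.

(** * Checkerboard droplets *)
Lemma in_arrayE (L : nat) (c i : site) : in_array L c i = (i \in grid L c).
Proof.
have dual (z w : int) (m : nat) :
    (z%:~R / 2 == w%:~R / 2 + m%:R :> rat) = (z == w + 2 * m%:Z).
  rewrite -(inj_eq (@intr_inj rat)) intrD intrM -[(m%:Z)%:~R]/(m%:R).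
  by apply/eqP/eqP; lra.
apply/existsP/gridP => [[m /existsP[n /andP[]]]|[[m n] /= [mL nL pE qE]]].
  rewrite /u1 /u2 !dual => /eqP pE /eqP qE.
  by exists (val m, val n); split=> //=; exact: ltn_ord.
exists (Ordinal mL); apply/existsP; exists (Ordinal nL).
by rewrite /u1 /u2 !dual -/(pcoord i) -/(qcoord i) pE qE /= !eqxx.
Qed.

(** The neighbours of an n x n grid lie in the (n+1) x (n+1) grid that is half a
    dual unit lower in both directions. *)
Lemma card_neighbourhood_grid (n : nat) (c : site) :
  (#|` neighbourhood (grid n c)| <= n.+1 * n.+1)%N.
Proof.
rewrite -(card_grid n.+1 (c.1 - 1, c.2)); apply/fsubset_leq_card/fsubsetP => j.
case/neighbourhoodP => i /gridP[[k l] /= [kn ln pE qE]].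
rewrite adj_coord => /andP[pij qij]; apply/gridP.
exists (absz ((pcoord j - pcoord c + 1) %/ 2)%Z,
        absz ((qcoord j - qcoord c + 1) %/ 2)%Z) => /=.
have -> : pcoord (c.1 - 1, c.2) = pcoord c - 1 by rewrite /pcoord /=; ring.
have -> : qcoord (c.1 - 1, c.2) = qcoord c - 1 by rewrite /qcoord /=; ring.
by split; lia.
Qed.

Lemma neighbourhood_grid_notin (n : nat) (c i : site) :
  i \in neighbourhood (grid n c) -> i \notin grid n c.
Proof.
case/neighbourhoodP => j /gridP[[k l] /= [_ _ pE _]].
rewrite adj_coord => /andP[pij _]; apply/gridP => -[[k' l'] /= [_ _ pE' _]].
lia.
Qed.

(** A checkerboard configuration in the form used for counting: the two species
    are given as sets of sites. *)
Definition droplet (L : nat) (a1 a2 : rat) (eta : config L a1 a2) (c : site) :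
    Prop :=
  [/\ grid L c `|` neighbourhood (grid L c) `<=` Lambda_minus L a1 a2,
      forall x, (eta x == 2 :> nat) = (val x \in grid L c)
    & forall x, (eta x == 1 :> nat) = (val x \in neighbourhood (grid L c))].

Lemma Lambda_minus_subset (L : nat) (a1 a2 : rat) :
  Lambda_minus L a1 a2 `<=` Lambda L a1 a2.
Proof. exact: fsubsetDl. Qed.

Lemma checkerboardP (L : nat) (a1 a2 : rat) (eta : config L a1 a2) :
  checkerboard eta <-> exists c, droplet eta c.
Proof.
have inL i : i \in Lambda_minus L a1 a2 -> exists x : Lambda L a1 a2, val x = i.
  by move=> /(fsubsetP (Lambda_minus_subset L a1 a2)) iL; exists [` iL].
split=> [[c [gridM nbrM eta2 eta1 eta0]]|[c [/fsubsetP sub eta2 eta1]]]; exists c.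
  have nbr1 (x : Lambda L a1 a2) :
      val x \in neighbourhood (grid L c) -> eta x = 1%N :> nat.
    case/neighbourhoodP => i ig ix; rewrite -in_arrayE in ig.
    by have [y yi] := inL i (gridM i ig); apply: (eta1 y); rewrite yi.
  have out0 (x : Lambda L a1 a2) : val x \notin grid L c ->
      val x \notin neighbourhood (grid L c) -> eta x = 0%N :> nat.
    move=> xg xn; apply: eta0; rewrite ?in_arrayE // => y yg.
    apply: contra xn => yx; apply/neighbourhoodP; exists (val y) => //.
    by rewrite -in_arrayE.
  split.
  - apply/fsubsetP => i; rewrite in_fsetU => /orP[ig|/neighbourhoodP[j jg ji]].
      by apply: gridM; rewrite in_arrayE.
    by apply: (nbrM j); rewrite ?in_arrayE.
  - move=> x; have [xg|xg] := boolP (val x \in grid L c).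
      by rewrite eta2 ?in_arrayE.
    have [/nbr1 ->//|xn] := boolP (val x \in neighbourhood (grid L c)).
    by rewrite out0.
  - move=> x; have [/nbr1 ->//|xn] := boolP (val x \in neighbourhood (grid L c)).
    have [xg|xg] := boolP (val x \in grid L c).
      by rewrite eta2 ?in_arrayE.
    by rewrite out0.
split.
- by move=> i; rewrite in_arrayE => ig; apply: sub; rewrite in_fsetU ig.
- move=> i j; rewrite in_arrayE => ig ij; apply: sub; rewrite in_fsetU.
  by apply/orP; right; apply/neighbourhoodP; exists i.
- by move=> x; rewrite in_arrayE -eta2 => /eqP.
- move=> x y; rewrite in_arrayE => xg xy; apply/eqP; rewrite eta1.
  by apply/neighbourhoodP; exists (val x).
- move=> y; rewrite in_arrayE -eta2 => y2 far.
  have y1 : eta y != 1%N :> nat.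
    rewrite eta1; apply/neighbourhoodP => -[i ig ij].
    have [x xi] : exists x : Lambda L a1 a2, val x = i.
      by apply: inL; apply: sub; rewrite in_fsetU ig.
    by have := far x; rewrite in_arrayE xi ig ij => /(_ isT).
  by move: (ltn_ord (eta y)) y2 y1; case: (nat_of_ord (eta y)) => [|[|[|]]].
Qed.

Definition droplet_energy (R : realType) (U D1 D2 : R) (L : nat) : R :=
  D1 * (L.+1 * L.+1)%:R + (D2 - 4 * U) * (L * L)%:R.

Lemma particlesP (L : nat) (a1 a2 : rat) (eta : config L a1 a2) k (i : site) :
  reflect (exists2 x, val x = i & x \in inner eta k) (i \in particles eta k).
Proof.
apply: (iffP idP) => [/imfsetP[x /= xk ->]|[x <- xk]]; first by exists x.
exact: in_imfset.
Qed.

Lemma energy_droplet_le (R : realType) (U D1 D2 : R) (L : nat) (a1 a2 : rat)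
    (eta : config L a1 a2) (c : site) :
  0 < D1 -> droplet eta c -> energy U D1 D2 eta <= droplet_energy U D1 D2 L.
Proof.
move=> D1_gt0 [/fsubsetP sub eta2 eta1].
have phase (k : nat) (S : {fset site}) :
    (forall x, (eta x == k :> nat) = (val x \in S)) ->
    {subset S <= Lambda_minus L a1 a2} ->
    particles eta k = S /\ [set x | eta x == k :> nat] :\: inner eta k = set0.
  move=> etak SM; split.
    apply/fsetP => i; apply/particlesP/idP => [[x <-]|iS].
      by rewrite in_inner etak => /andP[].
    have iL := fsubsetP (Lambda_minus_subset L a1 a2) _ (SM i iS).
    by exists [` iL] => //; rewrite in_inner etak /= iS SM.
  apply/setP => x; rewrite in_setD in_inner [x \in [set _ | _]]inE [RHS]inE etak.
  by have [/SM ->|] := boolP (val x \in S); rewrite ?andbF.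
have [A2E out2] :=
  phase _ _ eta2 (fun i ig => sub i (fsubsetP (fsubsetUl _ _) i ig)).
have [A1E out1] :=
  phase _ _ eta1 (fun i ig => sub i (fsubsetP (fsubsetUr _ _) i ig)).
rewrite energyE A2E A1E out2 out1 !cards0 !mulr0 !addr0.
rewrite (eq_big_seq (fun=> D2 - 4 * U)) => [|i ig]; last first.
  suff -> : ones_around (neighbourhood (grid L c)) i = 4%N by ring.
  apply/eqP; rewrite -[4%N]/(size (neighbours i)) -all_count; apply/allP => j jn.
  by apply/neighbourhoodP; exists i => //; rewrite adjE.
rewrite big_const_seq count_predT iter_addr addr0 card_grid.
rewrite /droplet_energy -[(D2 - 4 * U) *+ _]mulr_natr lerD2r ler_pM2l // ler_nat.
exact: card_neighbourhood_grid.
Qed.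

(** The interior window starts at twice the lower corner plus 2, and its lowest
    2 x 2 cell contains a site. *)
Lemma droplet_exists (L : nat) (a1 a2 : rat) (A B : int) :
  2 * a1 = A%:~R -> 2 * a2 = B%:~R ->
  exists (eta : config L a1 a2) (c : site), droplet eta c.
Proof.
move=> aA bB.
have [c cwin] : exists c, window (A + 2) (B + 2) 2 c.
  pose q := B + 2 + ((A + B) %% 2)%Z.
  (* q is the value of qcoord in the cell with the parity of pcoord = A + 2. *)
  exists (((A + 2 + q) %/ 2)%Z, ((q - (A + 2)) %/ 2)%Z).
  by rewrite /window /pcoord /qcoord /q /=; lia.
exists [ffun x => if val x \in grid L c then inord 2
                 else if val x \in neighbourhood (grid L c) then inord 1
                 else ord0], c.
split.
- apply/fsubsetP => i; rewrite in_fsetU (in_Lambda_minus_window L i aA bB).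
  case/orP => [/gridP[[k l] /= [kL lL pE qE]]|].
    by move: cwin; rewrite /window pE qE; lia.
  case/neighbourhoodP => j /gridP[[k l] /= [kL lL pE qE]].
  by rewrite adj_coord => /andP[pij qij]; move: cwin; rewrite /window; lia.
- move=> x; rewrite ffunE; case: ifP => [_|_]; first by rewrite inordK.
  by case: ifP => _; rewrite ?inordK.
- move=> x; rewrite ffunE; case: ifP => [xg|_].
    rewrite inordK //; apply/esym/negbTE.
    by apply: contraL xg; exact: neighbourhood_grid_notin.
  by case: ifP => _; rewrite ?inordK.
Qed.

Lemma energy_ge_droplet (R : realType) (U D1 D2 : R) (L : nat) (a1 a2 : rat)
    (A B : int) (eta : config L a1 a2) :
  2 * a1 = A%:~R -> 2 * a2 = B%:~R ->
  0 < D1 -> D1 < U -> 2 * U < D2 - D1 -> D1 + D2 < 4 * U -> (0 < L)%N ->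
  2 * D1 + (4 * U - D1 - D2) <= (4 * U - D1 - D2) * L%:R ->
  droplet_energy U D1 D2 L <= energy U D1 D2 eta /\
  (energy U D1 D2 eta <= droplet_energy U D1 D2 L -> exists c, droplet eta c).
Proof.
move=> aA bB D1_gt0 D1U D21 D12 L_gt0 eL.
have D2_gt0 : 0 < D2 by lra.
have disj : [disjoint particles eta 1 & particles eta 2].
  apply/fdisjointP => i /particlesP[x <-]; rewrite in_inner => /andP[_ /eqP x1].
  apply/particlesP => -[y /val_inj ->].
  by rewrite in_inner x1 andbF.
have partM k : {in particles eta k, forall i, i \in Lambda_minus L a1 a2}.
  by move=> i /particlesP[x <-]; rewrite in_inner => /andP[].
have A1in : {in particles eta 1,
    forall j, window (A + 2 - 1) (B + 2 - 1) (2 * L).+2 j}.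
  move=> j /partM; rewrite (in_Lambda_minus_window L j aA bB).
  by rewrite /window; lia.
have [] := droplet_bound D1_gt0 D1U D21 D12 L_gt0 eL disj A1in.
rewrite -/(droplet_energy U D1 D2 L) energyE.
set out1 := _ :\: inner eta 1; set out2 := _ :\: inner eta 2.
set E := _ + \sum_(_ <- _) _.
move=> le_E eq_E.
have o1 : 0 <= D1 * #|out1|%:R by rewrite mulr_ge0 // ltW.
have o2 : 0 <= D2 * #|out2|%:R by rewrite mulr_ge0 // ltW.
split=> [|E_le]; first by lra.
have [|c _ [A2E A1E]] := eq_E; first by lra.
have out1_0 : out1 = set0.
  apply/eqP; rewrite -cards_eq0 -(pnatr_eq0 R).
  rewrite -(mulrI_eq0 _ (lregP (lt0r_neq0 D1_gt0))).
  by apply/eqP; lra.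
have out2_0 : out2 = set0.
  apply/eqP; rewrite -cards_eq0 -(pnatr_eq0 R).
  rewrite -(mulrI_eq0 _ (lregP (lt0r_neq0 D2_gt0))).
  by apply/eqP; lra.
have inside k : [set x | eta x == k :> nat] :\: inner eta k = set0 ->
    forall x, (eta x == k :> nat) = (val x \in particles eta k).
  move=> /setP out x; apply/idP/particlesP => [xk|[y /val_inj ->]].
    exists x => //; apply: contraT => xI.
    by have := out x; rewrite in_setD xI in_set0 inE xk.
  by rewrite in_inner => /andP[].
exists c; split.
- by rewrite -A1E -A2E; apply/fsubsetP => i; rewrite in_fsetU => /orP[] /partM.
- by move=> x; rewrite (inside 2) // A2E.
- by move=> x; rewrite (inside 1) // A1E.
Qed.

Theorem theorem1p3 (R : realType) (U Delta1 Delta2 : R) (L : nat) (a1 a2 : rat)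
  (Delta1_gt0 : 0 < Delta1) (Delta1_lt_U : Delta1 < U)
  (Delta_diff : 2 * U < Delta2 - Delta1)
  (Delta_sum : Delta1 + Delta2 < 4 * U)
  (L_large : 2 * lstar U Delta1 Delta2 < L%:Z)
  (a1_half : half_integer a1) (a2_half : half_integer a2)
  (a1_centred : centred L a1) (a2_centred : centred L a2) :
  stable U Delta1 Delta2 L a1 a2 = boxplus L a1 a2.
Proof.
have [A aA] : exists A : int, 2 * a1 = A%:~R by apply/intrP; exact: a1_half.
have [B bB] : exists B : int, 2 * a2 = B%:~R by apply/intrP; exact: a2_half.
have e_gt0 : 0 < epsilon U Delta1 Delta2 by rewrite /epsilon; lra.
have eL : 2 * Delta1 + (4 * U - Delta1 - Delta2) <=
    (4 * U - Delta1 - Delta2) * L%:R.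
  rewrite -/(epsilon U Delta1 Delta2); set e := epsilon _ _ _ in e_gt0 *.
  have ceilD : Delta1 / e <= (lstar U Delta1 Delta2)%:~R by exact: ceil_ge.
  have LR : 2 * (lstar U Delta1 Delta2)%:~R + 1 <= L%:R :> R.
    rewrite -[2]/(2%:~R) -intrM -[1]/(1%:~R) -intrD -[L%:R]/(L%:Z%:~R).
    by rewrite ler_int; lia.
  have : e * (2 * (Delta1 / e) + 1) <= e * L%:R.
    by rewrite ler_pM2l //; lra.
  by rewrite mulrDr mulr1 mulrCA [e * (_ / _)]mulrC divfK // gt_eqF.
have L_gt0 : (0 < L)%N.
  by rewrite lt0n; apply/eqP => L0; move: eL e_gt0; rewrite L0 /epsilon; lra.
have ground := fun eta : config L a1 a2 =>
  energy_ge_droplet eta aA bB Delta1_gt0 Delta1_lt_U Delta_diff Delta_sum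
    L_gt0 eL.
have minE :
    min_energy U Delta1 Delta2 L a1 a2 = droplet_energy U Delta1 Delta2 L.
  apply/eqP; rewrite eq_le; apply/andP; split.
    have [eta [c etac]] := droplet_exists L aA bB.
    apply: le_trans (energy_droplet_le U Delta2 Delta1_gt0 etac).
    exact: bigmin_le_cond.
  by apply/le_bigmin => [|eta _]; exact: (ground _).1.
apply/setP => eta; rewrite !inE minE; apply/eqP/asboolP.
  by move=> etaE; apply/checkerboardP; apply: (ground eta).2; rewrite etaE.
case/checkerboardP => c etac; apply/eqP; rewrite eq_le (ground eta).1 andbT.
exact: energy_droplet_le etac.
Qed.
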